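(* For every $X\subseteq V$, put $R_X:=V\setminus X$, $S_X:=S_c(G)-R_X$, and $S_{X,C}:=S_c(G)-S(C)-R_X$ for $C\in\mathcal C(G)$. Then $$\det L_c[X,X]=m(S_X,|X|)+\sum_{\substack{C\in\mathcal C(G) \\ V(C)\subseteq X}}(-2)^{p(C)}\,c(C)\,m\bigl(S_{X,C},|X|-|C|\bigr).$$
   Context: $G=(V,E)$ is a finite connected simple undirected graph; each edge $e$ has a conductance $c_e\in\mathbb R_{>0}$. The weighted Laplacian $L_c$ is the $V\times V$ matrix with $(L_c)_{uu}=\sum_{e\ni u}c_e$, $(L_c)_{uv}=-c_{uv}$ if $uv\in E$, and $0$ otherwise. $L_c[X,X]$ is the principal submatrix on $X$, and the empty determinant equals $1$. The weighted subdivision graph $S_c(G)$ has vertex set $V\sqcup\{e^*:e\in E\}$ and, for each $e\in E$ and each endpoint $v$ of $e$, an edge $ve^*$ of weight $c_e$. For a subgraph $C$ of $G$, $S(C)$ is its subdivision, with vertices $V(C)\cup\{e^*:e\in E(C)\}$. Subtracting a vertex set (or a subgraph) from a graph means deleting those vertices (or all vertices of that subgraph) together with all incident edges. For an edge-weighted graph $H$, $m(H,j)$ is the total weight of its $j$-edge matchings, where the weight of a matching is the product of its edge weights (so $m(H,0)=1$). $\mathcal C(G)$ is the set of nonempty vertex-disjoint unions of cycles of $G$; for $C\in\mathcal C(G)$, $p(C)$ is its number of cycle components, $c(C)=\prod_{e\in E(C)}c_e$, and $|C|$ is its number of vertices (equal to its number of edges). *)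

(* Defs.v *)
From HB Require Import structures.
From mathcomp Require Import all_boot all_order all_algebra.

Set Implicit Arguments.
Unset Strict Implicit.
Unset Printing Implicit Defensive.

Import GRing.Theory.

Local Open Scope ring_scope.

(* A finite simple undirected graph whose vertices form a subset of an ambient
   finite type, so that subgraphs and vertex-deleted graphs live over the same
   type.  An edge is the two-element set of its endpoints. *)

Definition sgraph_axiom (T : finType) (d : {set T} * {set {set T}}) : bool :=
  [forall f in d.2, (#|f| == 2)%N && (f \subset d.1)].

Record sgraph (T : finType) : Type := SGraph {
  sgraph_data : {set T} * {set {set T}};
  sgraph_dataP : sgraph_axiom sgraph_data }.

HB.instance Definition _ (T : finType) := [isSub for @sgraph_data T].
HB.instance Definition _ (T : finType) := [Finite of sgraph T by <:].

Section Graphs.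

Variable T : finType.
Implicit Types G H C K : sgraph T.

Definition vset G : {set T} := (sgraph_data G).1.
Definition eset G : {set {set T}} := (sgraph_data G).2.

Lemma eset_card G f : f \in eset G -> #|f| = 2%N.
Proof. by move=> fG; have /forall_inP/(_ f fG)/andP[/eqP] := sgraph_dataP G. Qed.

Lemma eset_sub G f : f \in eset G -> f \subset vset G.
Proof. by move=> fG; have /forall_inP/(_ f fG)/andP[] := sgraph_dataP G. Qed.

Definition adj G : rel T := [rel u v | [set u; v] \in eset G].

Definition connected G : Prop :=
  {in vset G &, forall u v, connect (adj G) u v}.

Definition subgraph H G : bool :=
  (vset H \subset vset G) && (eset H \subset eset G).

Definition num_components G : nat := n_comp (adj G) (vset G).

Lemma delete_axiom G (A : {set T}) :
  sgraph_axiom (vset G :\: A, [set f in eset G | [disjoint f & A]]).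
Proof.
apply/forall_inP => f /=; rewrite inE => /andP[fG fA].
by rewrite (eset_card fG) eqxx subsetD eset_sub.
Qed.

Definition delete G (A : {set T}) : sgraph T := SGraph (delete_axiom G A).

(* [next s] closes the list up, so the edges are the pairs of cyclically
   consecutive entries of s. *)
Definition is_cycle K : bool :=
  (2 < #|vset K|)%N &&
  [exists s : #|vset K|.-tuple T,
     [&& uniq s, vset K == [set x in s]
       & eset K == [set [set x; next s x] | x in s]]].

Definition is_cycle_union G C : bool :=
  [exists P : {set sgraph T},
     [&& P != set0,
         [forall K in P, is_cycle K && subgraph K G],
         [forall K in P, forall K' in P,
            (K != K') ==> [disjoint vset K & vset K']],
         vset C == \bigcup_(K in P) vset K
       & eset C == \bigcup_(K in P) eset K]].

Definition cycle_unions G : {set sgraph T} := [set C | is_cycle_union G C].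

Definition is_matching H (M : {set {set T}}) : bool :=
  (M \subset eset H) && trivIset M.

Definition matching_weight (R : comNzRingType) (w : {set T} -> R) H (j : nat)
  : R :=
  \sum_(M : {set {set T}} | is_matching H M && (#|M| == j)%N)
    \prod_(f in M) w f.

Lemma subdivision_axiom G :
  sgraph_axiom
    ([set inl v | v in vset G] :|: [set inr f | f in eset G],
     [set [set (inl v : T + {set T}); inr f] | v in vset G, f in eset G
        & v \in f]).
Proof.
apply/forall_inP => _ /imset2P[v f vG + ->]; rewrite inE => /andP[fG _] /=.
rewrite cards2 /= subUset !sub1set !inE.
by rewrite (imset_f inl vG) (imset_f inr fG) orbT.
Qed.

(* The vertex v of G becomes [inl v], and e^* is [inr e]. *)
Definition subdivision G : sgraph (T + {set T})%type :=
  SGraph (subdivision_axiom G).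

(* An edge of a subdivision contains exactly one vertex e^*, so the product has
   exactly one factor; see subdivision_weightE. *)
Definition subdivision_weight (R : comNzRingType) (c : {set T} -> R)
    (f : {set (T + {set T})}) : R :=
  \prod_(e | inr e \in f) c e.

Lemma subdivision_weightE (R : comNzRingType) (c : {set T} -> R) v e :
  subdivision_weight c [set inl v; inr e] = c e.
Proof.
by rewrite /subdivision_weight (big_pred1 e) // => e'; rewrite !inE.
Qed.

End Graphs.

Section Laplacian.

Variables (R : comNzRingType) (V : finType) (G : sgraph V) (c : {set V} -> R).

(* Matrices over V are indexed through the canonical enumeration of V. *)
Definition laplacian : 'M[R]_#|V| :=
  \matrix_(i, j)
    let u := enum_val i in let v := enum_val j in
    if u == v then \sum_(f in eset G | u \in f) c f
    else if [set u; v] \in eset G then - c [set u; v] else 0.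

End Laplacian.

Definition principal_submx (R : Type) (V : finType) (A : 'M[R]_#|V|)
    (X : {set V}) : 'M[R]_#|X| :=
  let r (i : 'I_#|X|) := enum_rank (enum_val i : V) in mxsub r r A.

(* Main.v *)
(* Expand the determinant over permutations s supported on X and group the terms
   by the graph C whose edges {v, s v} come from the cycles of s of length at
   least 3; then s = t i with t supported on V(C) and i an involution on the rest.
   - For fixed C the possible t are obtained by orienting each component of C,
     which gives 2^p(C) permutations, each contributing (-1)^p(C) c(C).
   - For the involutions, expand every diagonal entry into a choice f(v) of an
     edge at v. An off-diagonal entry at v is a choice f(v) containing both v and
     i v, so the sum is over pairs (i, f) with v, i v in f(v). For fixed f the
     signed sum over i vanishes as soon as two vertices choose the same edge, and
     is 1 otherwise. The injective f are the matchings of the subdivision graph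
     that saturate the remaining vertices. *)

Require Import Defs.
From mathcomp Require Import all_boot all_order all_algebra all_fingroup.

Set Implicit Arguments.
Unset Strict Implicit.
Unset Printing Implicit Defensive.

Import GRing.Theory Num.Theory GroupScope.

Local Open Scope ring_scope.

(** * Determinants of principal submatrices *)

Section PermExtension.

Variables (S T : finType) (r : S -> T).
Hypothesis r_inj : injective r.
Implicit Type s : {perm S}.

Let ext_fun s (x : T) : T :=
  if [pick i | r i == x] is Some i then r (s i) else x.

Let ext_fun_r s i : ext_fun s (r i) = r (s i).
Proof.
rewrite /ext_fun; case: pickP => [j /eqP/r_inj-> //|/(_ i)].
by rewrite eqxx.
Qed.

Let ext_fun_out s x : x \notin codom r -> ext_fun s x = x.
Proof.
rewrite /ext_fun; case: pickP => // i /eqP<-.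
by rewrite codom_f.
Qed.

Let ext_fun_inj s : injective (ext_fun s).
Proof.
apply: (can_inj (g := ext_fun s^-1)) => x.
have [/codomP[i ->]|xr] := boolP (x \in codom r).
  by rewrite !ext_fun_r permK.
by rewrite !(ext_fun_out _ xr).
Qed.

(** Carries permutations of the index type of a principal submatrix to permutations of [V] supported
    on [X], so that one permutation type serves every [X]. *)
Definition perm_ext s : {perm T} := perm (@ext_fun_inj s).

Lemma perm_extE s i : perm_ext s (r i) = r (s i).
Proof. by rewrite permE ext_fun_r. Qed.

Lemma perm_ext_out s x : x \notin codom r -> perm_ext s x = x.
Proof. by move=> xr; rewrite permE ext_fun_out. Qed.

Lemma perm_ext_inj : injective perm_ext.
Proof.
move=> s t st; apply/permP => i; apply: r_inj.
by rewrite -!perm_extE st.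
Qed.

Lemma perm_extM s t : perm_ext (s * t)%g = (perm_ext s * perm_ext t)%g.
Proof.
apply/permP => x; rewrite permM.
have [/codomP[i ->]|xr] := boolP (x \in codom r).
  by rewrite !perm_extE permM.
by rewrite !(perm_ext_out _ xr).
Qed.

Lemma perm_ext1 : perm_ext 1%g = 1%g.
Proof.
apply/permP => x; rewrite perm1.
have [/codomP[i ->]|xr] := boolP (x \in codom r).
  by rewrite !perm_extE perm1.
by rewrite !(perm_ext_out _ xr).
Qed.

Lemma perm_ext_tperm i j : perm_ext (tperm i j) = tperm (r i) (r j).
Proof.
apply/permP => x.
have [/codomP[k ->]|xr] := boolP (x \in codom r).
  by rewrite perm_extE inj_tperm.
rewrite perm_ext_out // tpermD //.
  by apply: contraNneq xr => <-; rewrite codom_f.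
by apply: contraNneq xr => <-; rewrite codom_f.
Qed.

(** [perm_ext] is multiplicative and sends transpositions to transpositions, so a factorisation of
    [s] into transpositions transfers factor by factor. *)
Lemma odd_perm_ext s : odd_perm (perm_ext s) = odd_perm s.
Proof.
have [ts -> _] := prod_tpermP s.
elim: ts => [|[i j] ts IH]; first by rewrite !big_nil perm_ext1 !odd_perm1.
by rewrite !big_cons perm_extM !odd_permM IH perm_ext_tperm !odd_tperm inj_eq.
Qed.

Lemma perm_ext_on s : perm_on [set x in codom r] (perm_ext s).
Proof.
by apply/subsetP => x; rewrite !inE; apply: contraR => /perm_ext_out/eqP.
Qed.

(** One inclusion suffices, since both sides have [#|S|] factorial elements. *)
Lemma perm_ext_image :
  perm_ext @: [set: {perm S}] = [set t | perm_on [set x in codom r] t].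
Proof.
apply/eqP; rewrite eqEcard; apply/andP; split.
  by apply/subsetP => _ /imsetP[s _ ->]; rewrite inE perm_ext_on.
rewrite card_imset; last exact: perm_ext_inj.
have -> : #|[set t | perm_on [set x in codom r] t]| = (#|S|)`!.
  by rewrite cardsE (card_perm [set x in codom r]) cardsE card_codom.
have -> : #|[set: {perm S}]| = (#|S|)`!; last by [].
rewrite -cardsT -(card_perm [set: S]); apply: eq_card => s; rewrite inE.
by symmetry; apply/subsetP => x; rewrite inE.
Qed.

End PermExtension.

Lemma det_principal_submx (R : comNzRingType) (V : finType) (A : V -> V -> R)
    (X : {set V}) (B : 'M[R]_#|V|) :
  (forall u v, B (enum_rank u) (enum_rank v) = A u v) ->
  \det (principal_submx B X) =
    \sum_(s : {perm V} | perm_on X s) (-1) ^+ s * \prod_(x in X) A x (s x).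
Proof.
move=> BE; pose r (i : 'I_#|X|) : V := enum_val i.
have r_inj : injective r by apply: enum_val_inj.
have XE : [set x in codom r] = X.
  apply/setP => x; rewrite inE; apply/codomP/idP => [[i ->]|xX].
    exact: enum_valP.
  by exists (enum_rank_in xX x); rewrite /r enum_rankK_in.
transitivity (\sum_(s in perm_ext r_inj @: [set: {perm 'I_#|X|}])
    (-1) ^+ s * \prod_(x in X) A x (s x)); last first.
  by apply: eq_bigl => s; rewrite perm_ext_image XE inE.
rewrite big_imset /=; last by move=> s t _ _; apply: perm_ext_inj.
apply: eq_big => [s|s _]; first by rewrite inE.
rewrite odd_perm_ext; congr (_ * _).
rewrite [RHS]big_enum_val.
by apply: eq_bigr => i _; rewrite !mxE BE (perm_extE r_inj).
Qed.

(** * Involutions and choices of edges *)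

Section Involutions.

Variables (R : comNzRingType) (V : finType) (G : sgraph V) (c : {set V} -> R).
Implicit Types (Y : {set V}) (s : {perm V}) (f : {ffun V -> {set V}}).

Definition laplacian_entry (u v : V) : R :=
  if u == v then \sum_(e in eset G | u \in e) c e
  else if [set u; v] \in eset G then - c [set u; v] else 0.

Lemma edge_set2 e u v :
  e \in eset G -> u \in e -> v \in e -> u != v -> e = [set u; v].
Proof.
move=> eG ue ve uv; apply/esym/eqP; rewrite eqEcard subUset !sub1set ue ve.
by rewrite (eset_card eG) cards2 uv.
Qed.

(** Two distinct vertices share at most one edge, so the off-diagonal sum has at most one term.
    Having one formula for all entries lets a product of entries expand into choices of edges. *)
Lemma laplacian_entryE u v :
  laplacian_entry u v =
  (-1) ^+ (u != v) * \sum_(e in eset G | (u \in e) && (v \in e)) c e.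
Proof.
rewrite /laplacian_entry; case: eqVneq => [<-|uv] /=.
  by rewrite mul1r; apply: eq_bigl => e; rewrite andbb.
rewrite mulN1r; case: ifPn => uvG.
  rewrite (big_pred1 [set u; v]) // => e /=; apply/idP/eqP => [|->].
    by case/and3P => eG ue ve; apply: edge_set2.
  by rewrite uvG !inE !eqxx orbT.
rewrite big_pred0 ?oppr0 // => e; apply: contraNF uvG => /and3P[eG ue ve].
by rewrite -(edge_set2 eG ue ve uv).
Qed.

(** The fixed value [set0] outside [Y] makes a choice determined by its restriction to [Y]. *)
Definition edge_choices Y : {pred {ffun V -> {set V}}} :=
  pfamily set0 Y (fun v => [pred e in eset G | v \in e]).

Lemma edge_choicesP Y f :
  reflect ((forall v, v \notin Y -> f v = set0) /\
           (forall v, v \in Y -> f v \in eset G /\ v \in f v))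
          (f \in edge_choices Y).
Proof.
rewrite /edge_choices; apply: (iffP pfamilyP) => [[/subsetP supp fY]|[supp fY]]; split.
- by move=> v; apply: contraNeq; apply: supp.
- by move=> v /fY/andP.
- by apply/subsetP => v; apply: contraR => /supp/eqP.
- by move=> v /fY[fG vf]; rewrite inE /= fG.
Qed.

(** The sign of [s] together with the minus signs of the off-diagonal entries it selects. *)
Let sgn_moved Y s : R := (-1) ^+ s * \prod_(v in Y) (-1) ^+ (v != s v).

(* If two vertices choose the same edge uv, then composing with (u v) is a
   sign-reversing bijection; otherwise only the identity is compatible. *)
Lemma compatible_involutions_sum Y f :
  f \in edge_choices Y ->
  \sum_(s | [&& perm_on Y s, (s * s == 1)%g & [forall v in Y, s v \in f v]])
      sgn_moved Y s
  = (dinjectiveb f Y)%:R.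
Proof.
case/edge_choicesP => _ fY; case: (boolP (dinjectiveb f Y)) => [/dinjectiveP|].
  move=> f_inj; rewrite (big_pred1 1%g) => [|s /=].
    rewrite /sgn_moved odd_perm1 mul1r big1 // => v _.
    by rewrite perm1 eqxx.
  apply/and3P/eqP => [[sY /eqP ss /forall_inP sf]|->]; last first.
    rewrite perm_on1 mulg1 eqxx; split=> //; apply/forall_inP => v vY.
    by rewrite perm1; case: (fY v vY).
  apply/permP => v; rewrite perm1.
  have [vY|/out_perm->//] := boolP (v \in Y).
  have svY : s v \in Y by rewrite perm_closed.
  (* If [s] moved [v], both [f v] and [f (s v)] would be the edge joining [v] and [s v], against
     injectivity. *)
  apply/eqP; apply: contraTT isT => svv.
  have [fvG vfv] := fY _ vY; have [fsvG svfsv] := fY _ svY.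
  have ssv : s (s v) = v by rewrite -permM ss perm1.
  have := sf _ svY; rewrite ssv => vfsv.
  have vsv : v != s v by rewrite eq_sym.
  case/eqP: svv; apply: f_inj => //.
  by rewrite (edge_set2 fvG vfv (sf _ vY) vsv) (edge_set2 fsvG vfsv svfsv vsv).
case/dinjectivePn => u uY [v /andP[/= vu vY] fuv].
have uv : u != v by rewrite eq_sym.
have [fuG ufu] := fY _ uY; have [_ vfv] := fY _ vY.
have fu : f u = [set u; v] by apply: edge_set2; rewrite // fuv.
pose t := tperm u v.
pose P s := [&& perm_on Y s, (s * s == 1)%g & [forall v in Y, s v \in f v]].
change (\sum_(s | P s) sgn_moved Y s = 0).
(* Both [s u] and [s v] lie in the edge [[set u; v]], so [s] fixes or exchanges its ends. Hence [t]
   commutes with [s], and [t * s] is again compatible. *)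
have swap s : P s -> (s u = u /\ s v = v) \/ (s u = v /\ s v = u).
  case/and3P => _ _ /forall_inP sf.
  have := sf v vY; have := sf u uY; rewrite -fuv fu !inE.
  have suv : s u != s v by rewrite (inj_eq perm_inj).
  by case/orP => /eqP su /orP[] /eqP sv; move: suv; rewrite su sv ?eqxx; auto.
have Pt s : P s -> P (t * s)%g.
  move=> Ps; have sw := swap s Ps; case/and3P: Ps => sY /eqP ss /forall_inP sf.
  have tY : perm_on Y t.
    apply: subset_trans (tperm_on u v) _.
    by rewrite subUset !sub1set uY vY.
  have ts : (t * s = s * t)%g.
    rewrite conjgC /t tpermJ; congr (_ * _)%g.
    by case: sw => [[-> ->]|[-> ->]] //; rewrite tpermC.
  apply/and3P; split; first exact: perm_onM.
    by rewrite {1}ts mulgA -(mulgA s) tperm2 mulg1 ss.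
  apply/forall_inP => x xY; rewrite permM.
  case: tpermP => [xu|xv|_ _]; last exact: sf.
    by rewrite xu fuv; apply: sf.
  by rewrite xv -fuv; apply: sf.
have PtE s : P (t * s)%g = P s.
  by apply/idP/idP => /Pt //; rewrite mulgA tperm2 mul1g.
(* Multiplication by [t] exchanges the permutations fixing [u] with those moving it, and the two
   halves cancel. *)
rewrite (bigID (fun s : {perm V} => s u == u)) /=.
rewrite [X in _ + X](reindex_inj (mulgI t)) /=; apply/eqP; rewrite addr_eq0.
rewrite -sumrN; apply/eqP; apply: eq_big => [s|s /andP[Ps /eqP su]].
  rewrite PtE permM tpermL; apply: andb_id2l => /swap[] [-> ->].
    by rewrite eqxx vu.
  by rewrite eqxx (negPf vu).
have {Ps} sv : s v = v by case: (swap s Ps) => [[]//|[]]; rewrite su => ->.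
rewrite /sgn_moved odd_mul_tperm uv signr_addb expr1 mulN1r mulNr opprK.
congr (_ * _).
(* At [u] and [v] the factors are both [1] for [s] and both [-1] for [t * s], so the products agree
   and the sign of [t] alone makes the terms opposite. *)
have split_uv (h : V -> R) :
    \prod_(x in Y) h x =
    h u * h v * \prod_(x in Y | (x != u) && (x != v)) h x.
  rewrite (bigD1 u uY) (bigD1 v) /=; last exact/andP.
  rewrite mulrA; congr (_ * _).
  by apply: eq_bigl => x; rewrite andbA.
rewrite [LHS]split_uv [RHS]split_uv.
rewrite !permM tpermL tpermR su sv !eqxx uv vu /= mulrNN.
congr (_ * _); apply: eq_bigr => x /and3P[_ xu xv].
by rewrite permM tpermD // eq_sym.
Qed.

(** Expand each entry into the edges containing both [v] and [s v], then exchange the sums: each [f]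
    is left with the signed count of its compatible [s], which is [1] or [0]. *)
Lemma involution_sum Y :
  \sum_(s | perm_on Y s && (s * s == 1)%g)
     (-1) ^+ s * \prod_(v in Y) laplacian_entry v (s v)
  = \sum_(f in edge_choices Y | dinjectiveb f Y) \prod_(v in Y) c (f v).
Proof.
transitivity (\sum_(s | perm_on Y s && (s * s == 1)%g)
  \sum_(f in pfamily set0 Y
              (fun v => [pred e in eset G | (v \in e) && (s v \in e)]))
     sgn_moved Y s * \prod_(v in Y) c (f v)).
  apply: eq_bigr => s _.
  under eq_bigr => v _ do rewrite laplacian_entryE.
  by rewrite big_split /= mulrA (big_distr_big_dep set0) mulr_sumr.
rewrite (exchange_big_dep (fun f => f \in edge_choices Y)) /=; last first.
  move=> s f _ /pfamilyP[supp fY]; apply/pfamilyP; split=> // v /fY.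
  by rewrite !inE => /and3P[-> ->].
rewrite [RHS]big_mkcondr; apply: eq_bigr => f fY.
rewrite -mulr_suml -mulrb -[RHS]mulr_natl -compatible_involutions_sum //.
congr (_ * _); apply: eq_bigl => s; rewrite -andbA; congr [&& _, _ & _].
case/edge_choicesP: fY => supp fY.
apply/pfamilyP/forall_inP => [[_ sf] v /sf|sf].
  by rewrite inE => /and3P[].
split=> [|v vY]; first by apply/subsetP => v; apply: contraR => /supp/eqP.
by have [fG vf] := fY _ vY; rewrite inE fG vf sf.
Qed.

End Involutions.

(** * Saturating matchings of the subdivision *)

Section SubdivisionMatchings.

Variables (R : comNzRingType) (V : finType) (G : sgraph V) (c : {set V} -> R).

Definition half_edge (v : V) (e : {set V}) : {set V + {set V}} :=
  [set inl v; inr e].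

Lemma half_edge_inj v e v' e' :
  half_edge v e = half_edge v' e' -> v = v' /\ e = e'.
Proof.
move=> eqh; split.
  have : inl v \in half_edge v' e' by rewrite -eqh !inE eqxx.
  by rewrite !inE orbF => /eqP[].
have : inr e \in half_edge v' e' by rewrite -eqh !inE eqxx orbT.
by rewrite !inE => /eqP[].
Qed.

Lemma disjoint_half_edges v e v' e' :
  [disjoint half_edge v e & half_edge v' e'] = (v != v') && (e != e').
Proof.
rewrite -setI_eq0; apply/eqP/andP => [/setP dis|[vv' ee']].
  split; apply/eqP => eqve.
    by have := dis (inl v); rewrite !inE eqve eqxx.
  by have := dis (inr e); rewrite !inE eqve eqxx.
apply/setP => -[x|x]; rewrite !inE ?orbF /=.
  by apply: contraNF vv' => /andP[/eqP[<-] /eqP[<-]].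
by apply: contraNF ee' => /andP[/eqP[<-] /eqP[<-]].
Qed.

Definition choice_matching (Y : {set V}) (f : {ffun V -> {set V}}) :
    {set {set (V + {set V})%type}} :=
  [set half_edge v (f v) | v in Y].

(** Each edge of [H] contains exactly one [inl v], with [v] in [Y], so a matching with [#|Y|] edges
    covers every such vertex. It amounts to a choice of an edge at each [v], and disjointness at the
    vertices [inr e] is injectivity of the choice. *)
Lemma matching_weight_choices (H : sgraph (V + {set V})%type) (Y : {set V}) :
  eset H = [set half_edge v e | v in Y, e in eset G & v \in e] ->
  matching_weight (subdivision_weight c) H #|Y| =
  \sum_(f in edge_choices G Y | dinjectiveb f Y) \prod_(v in Y) c (f v).
Proof.
move=> EH.
have half_inj (f : {ffun V -> {set V}}) :
    {in Y &, injective (fun v => half_edge v (f v))}.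
  by move=> u v _ _ /half_edge_inj[].
pose D := [set f in edge_choices G Y | dinjectiveb f Y].
have choice_inj : {in D &, injective (choice_matching Y)}.
  move=> f g; rewrite !inE => /andP[/edge_choicesP[f0 _] _].
  case/andP => /edge_choicesP[g0 _] _ fg; apply/ffunP => v.
  have [vY|vY] := boolP (v \in Y); last by rewrite f0 ?g0.
  have : half_edge v (f v) \in choice_matching Y g.
    by rewrite -fg; apply/imsetP; exists v.
  by case/imsetP => u uY /half_edge_inj[-> ->].
transitivity (\sum_(f in D) \prod_(v in Y) c (f v)); last first.
  by apply: eq_bigl => f; rewrite inE.
transitivity (\sum_(f in D)
    \prod_(m in choice_matching Y f) subdivision_weight c m); last first.
  apply: eq_bigr => f _; rewrite big_imset //=.
  by apply: eq_bigr => v _; rewrite subdivision_weightE.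
rewrite -(big_imset (fun M : {set {set (V + {set V})%type}} =>
    \prod_(m in M) subdivision_weight c m)) //=.
apply: eq_bigl => M; apply/idP/imsetP => [|[f]]; last first.
  rewrite inE => /andP[/edge_choicesP[_ fY] /dinjectiveP f_inj] ->.
  rewrite /is_matching /choice_matching (card_in_imset (@half_inj f)) eqxx andbT.
  apply/andP; split.
    apply/subsetP => _ /imsetP[v vY ->]; have [fG vf] := fY v vY.
    by rewrite EH; apply/imset2P; exists v (f v); rewrite ?inE ?fG.
  apply/trivIsetP => _ _ /imsetP[u uY ->] /imsetP[v vY ->] uv.
  have {}uv : u != v by apply: contraNneq uv => ->.
  by rewrite disjoint_half_edges uv (inj_in_eq f_inj).
case/andP => /andP[/subsetP MH /trivIsetP Mtriv] /eqP Mcard.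
have Mhalf m : m \in M -> exists v e,
    [/\ v \in Y, e \in eset G, v \in e & m = half_edge v e].
  move/MH; rewrite EH => /imset2P[v e vY]; rewrite inE => /andP[eG ve] ->.
  by exists v, e.
(* The partner of [v] in [M], with the default value that [edge_choices] prescribes for unmatched
   vertices. *)
pose f := [ffun v => odflt set0 [pick e | half_edge v e \in M]].
have fE v e : half_edge v e \in M -> f v = e.
  move=> veM; rewrite ffunE; case: pickP => [e' /= ve'M|/(_ e)].
    apply/eqP; apply: contraT => ee'.
    have := Mtriv _ _ ve'M veM; rewrite disjoint_half_edges eqxx /=; apply.
    by apply: contraNneq ee' => /half_edge_inj[_ ->].
  by rewrite veM.
pose A := [set v | half_edge v (f v) \in M].
have MA : M = choice_matching A f.
  apply/setP => m; apply/idP/imsetP => [mM|[v]]; last by rewrite inE => ? ->.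
  have [v [e [vY eG ve me]]] := Mhalf m mM; exists v.
    by rewrite inE (fE v e) -?me.
  by rewrite (fE v e) -?me.
(* The matched vertices lie in [Y], and there are at least [#|M| = #|Y|] of them. *)
have AY : A = Y.
  apply/eqP; rewrite eqEcard; apply/andP; split.
    apply/subsetP => v; rewrite inE => /Mhalf[u [e [uY _ _]]].
    by case/half_edge_inj => ->.
  by rewrite -Mcard {1}MA leq_imset_card.
have fM v : v \in Y -> half_edge v (f v) \in M by rewrite -AY inE.
exists f; last by rewrite -AY.
rewrite inE; apply/andP; split.
  apply/edge_choicesP; split=> v.
    rewrite ffunE; case: pickP => // e /Mhalf[u [e' [uY _ _]]].
    by case/half_edge_inj => ->; rewrite uY.
  by move=> /fM/Mhalf[u [e [uY eG ue]]] /half_edge_inj[-> ->].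
apply/dinjectiveP => u v uY vY fuv; apply/eqP; apply: contraT => uv.
have := Mtriv _ _ (fM u uY) (fM v vY).
rewrite disjoint_half_edges fuv eqxx andbF; apply.
by apply: contraNneq uv => /half_edge_inj[->].
Qed.

End SubdivisionMatchings.

(** * Permutations orienting a union of cycles *)

Section PermGraph.

Variable V : finType.
Implicit Types (s t : {perm V}) (C : sgraph V).

Lemma sgraph_eq C D : vset C = vset D -> eset C = eset D -> C = D.
Proof.
move=> vCD eCD; apply: val_inj => /=.
by rewrite [sgraph_data C]surjective_pairing [sgraph_data D]surjective_pairing;
  congr (_, _).
Qed.

(** These are the vertices on cycles of [s] of length at least 3. *)
Definition long_support s : {set V} := [set v | s (s v) != v].

Lemma long_support_perm s v : (s v \in long_support s) = (v \in long_support s).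
Proof. by rewrite !inE (inj_eq perm_inj). Qed.

Lemma long_support_moved s v : v \in long_support s -> s v != v.
Proof. by rewrite inE; apply: contraNneq => sv; rewrite !sv. Qed.

Lemma set2_eq (T : finType) (u v x y : T) :
  [set u; v] = [set x; y] -> (u = x /\ v = y) \/ (u = y /\ v = x).
Proof.
move=> /setP eqs; move: (eqs u) (eqs v) (eqs x) (eqs y).
rewrite !inE !eqxx ?orbT /= => /esym/orP[]/eqP-> /esym/orP[]/eqP->;
  rewrite ?eqxx ?orbb /=.
- by move=> _ /eqP->; left.
- by left.
- by right.
- by move/eqP->; left.
Qed.

Lemma perm_graph_axiom s :
  sgraph_axiom (long_support s, [set [set v; s v] | v in long_support s]).
Proof.
apply/forall_inP => _ /imsetP[v vs ->] /=.
rewrite cards2 (eq_sym v) long_support_moved //= subUset !sub1set.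
by rewrite long_support_perm vs.
Qed.

(* Fixed points and 2-cycles of [s] are discarded. *)
Definition perm_graph s : sgraph V := SGraph (perm_graph_axiom s).

(** Two distinct vertices giving the same edge would form a 2-cycle of [s]. *)
Lemma perm_edge_inj s :
  {in long_support s &, injective (fun v => [set v; s v])}.
Proof.
move=> u v us _ /set2_eq[[]//|[uv suv]].
by move: us; rewrite inE suv uv eqxx.
Qed.

(** The support condition excludes 2-cycles outside [C], which [perm_graph] does not see. What
    remains is a direction on each cycle of [C]. *)
Definition orients s C : bool := perm_on (vset C) s && (perm_graph s == C).

Lemma orients_vset s C : orients s C -> vset C = long_support s.
Proof. by case/andP => _ /eqP<-. Qed.

Lemma orients_eset s C :
  orients s C -> eset C = [set [set v; s v] | v in long_support s].
Proof. by case/andP => _ /eqP<-. Qed.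

Lemma orientsP s C :
  vset C = long_support s -> {in vset C, forall v, [set v; s v] \in eset C} ->
  {subset eset C <= [set [set v; s v] | v in vset C]} ->
  (forall v, v \notin vset C -> s v = v) -> orients s C.
Proof.
move=> vC sC Cs s_out; apply/andP; split.
  by apply/subsetP => v; rewrite inE; apply: contraR => /s_out/eqP.
apply/eqP/sgraph_eq => //; apply/setP => e; apply/idP/idP => [|/Cs].
  by case/imsetP => v vs ->; apply: sC; rewrite vC.
by rewrite vC.
Qed.

(** * Orbits and sign of an orienting permutation *)

Section Oriented.

Variables (s : {perm V}) (C : sgraph V).
Hypothesis sC : orients s C.

Lemma orients_out v : v \notin vset C -> s v = v.
Proof. by case/andP: sC => sC' _; apply: out_perm. Qed.

Lemma orients_perm v : (s v \in vset C) = (v \in vset C).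
Proof. by rewrite (orients_vset sC) long_support_perm. Qed.

Lemma orients_edge v : v \in vset C -> [set v; s v] \in eset C.
Proof.
by rewrite (orients_vset sC) (orients_eset sC) => vs; apply: imset_f.
Qed.

Lemma orients_adj u v : adj C u v -> v = s u \/ u = s v.
Proof.
rewrite /adj /= (orients_eset sC) => /imsetP[x _ /set2_eq[]] [-> ->]; auto.
Qed.

(** Every edge of [C] is a step of [s], forwards or backwards, so components of [C] can be handled
    as orbits of [s]. *)
Lemma connect_orients : connect (adj C) =2 fconnect s.
Proof.
move=> u v; apply/idP/idP; move: u v; apply: connect_sub => u v.
  case/orients_adj => ->; first exact: fconnect1.
  by rewrite (fconnect_sym perm_inj) fconnect1.
move/eqP<-; have [uC|/orients_out->] := boolP (u \in vset C).
  exact/connect1/orients_edge.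
exact: connect0.
Qed.

Lemma orients_connect_sym : connect_sym (adj C).
Proof. by move=> u v; rewrite !connect_orients (fconnect_sym perm_inj). Qed.

Lemma orients_root_perm v : fingraph.root (adj C) (s v) = fingraph.root (adj C) v.
Proof.
apply/(fingraph.rootP orients_connect_sym).
by rewrite orients_connect_sym connect_orients fconnect1.
Qed.

Lemma orients_closed : closed (adj C) (vset C).
Proof. by move=> u v /orients_adj[] ->; rewrite orients_perm. Qed.

Lemma orients_root_vset v : (fingraph.root (adj C) v \in vset C) = (v \in vset C).
Proof.
exact/esym/(closed_connect orients_closed)/connect_root.
Qed.

Lemma orients_root_out v : v \notin vset C -> fingraph.root (adj C) v = v.
Proof.
move/orients_out => sv; have := connect_root (adj C) v.
rewrite connect_orients => /iter_findex <-.
by elim: (findex _ _ _) => //= n ->.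
Qed.

Lemma card_porbits_orients : #|porbits s| = n_comp (adj C) V.
Proof.
have fconnE u v : fconnect s u v = (v \in porbit s u).
  apply/idP/porbitP => [/iter_findex <-|[i ->]].
    by exists (findex s u v); rewrite permX.
  by rewrite permX fconnect_iter.
have -> : porbits s = porbit s @: [set x in roots (adj C)].
  apply/setP => A; apply/imsetP/imsetP => -[x _ ->]; last by exists x.
  exists (fingraph.root (adj C) x).
    by rewrite inE; apply: roots_root orients_connect_sym _.
  apply/eqP; rewrite eq_porbit_mem -fconnE -connect_orients.
  by rewrite orients_connect_sym connect_root.
rewrite card_in_imset => [|x y].
  by rewrite cardsE; apply: eq_card => x; rewrite !inE andbT.
rewrite !inE => /eqP rx /eqP ry /eqP; rewrite eq_porbit_mem -fconnE.
rewrite -connect_orients orients_connect_sym.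
by move/(fingraph.rootP orients_connect_sym); rewrite rx ry.
Qed.

(** The sign of [s] is the parity of [#|V|] plus the number of orbits. Each vertex outside [C] is
    fixed and adds one to both counts, so these contributions cancel. *)
Lemma odd_orients :
  odd_perm s = odd #|vset C| (+) odd (num_components C).
Proof.
rewrite /odd_perm card_porbits_orients (n_compC (vset C)) oddD -/(num_components C).
have -> : n_comp (adj C) [predC vset C] = #|~: vset C|.
  apply: eq_card => v; rewrite !inE andbC; case: (boolP (v \in vset C)) => //= vC.
  by rewrite /roots orients_root_out ?eqxx.
rewrite -(cardsC (vset C)) oddD; do 3!case: odd => //.
Qed.

End Oriented.

(** * Reversing orientations component by component *)

Section Flips.

Variables (s0 : {perm V}) (C : sgraph V).
Hypothesis s0C : orients s0 C.

Let root := fingraph.root (adj C).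

(** For [b = false], runs [s0] backwards on the components with root in [B]. Negating [b] exchanges
    reversed and kept components, which gives the inverse the same form. *)
Let flip_fun (B : {set V}) (b : bool) (v : V) : V :=
  if (root v \in B) (+) b then s0^-1%g v else s0 v.

Let root_inv v : root (s0^-1%g v) = root v.
Proof. by rewrite -[in RHS](permKV s0 v) /root (orients_root_perm s0C). Qed.

Let flip_funK B b : cancel (flip_fun B b) (flip_fun B (~~ b)).
Proof.
move=> v; rewrite /flip_fun addbN.
case: (boolP ((root v \in B) (+) b)) => [vB|/negPf vB].
  by rewrite root_inv vB permKV.
by rewrite /root (orients_root_perm s0C) -/root vB permK.
Qed.

Definition flip B : {perm V} := perm (can_inj (flip_funK B false)).

Lemma flipE B v : flip B v = if root v \in B then s0^-1%g v else s0 v.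
Proof. by rewrite permE /flip_fun addbF. Qed.

Lemma flip_orients B : orients (flip B) C.
Proof.
have sV v : (s0^-1%g v \in vset C) = (v \in vset C).
  by rewrite -(orients_perm s0C) permKV.
have rV := root_inv; have r0 v : root (s0 v) = root v := orients_root_perm s0C v.
apply: orientsP.
- apply/setP => v; rewrite (orients_vset s0C) !inE !flipE.
  case: (boolP (root v \in B)) => [vB|/negPf vB]; rewrite ?rV ?r0 vB //.
  congr negb; apply/eqP/eqP => vv; first by rewrite -{1}vv !permK.
  by rewrite -{1}vv !permKV.
- move=> v vC; rewrite flipE; case: ifP => _; last exact: orients_edge.
  have := orients_edge s0C (v := s0^-1%g v); rewrite sV permKV setUC.
  exact.
- move=> e; rewrite (orients_eset s0C) -(orients_vset s0C) => /imsetP[v vC ->].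
  have [vB|vB] := boolP (root v \in B); last first.
    by apply/imsetP; exists v; rewrite // flipE (negPf vB).
  apply/imsetP; exists (s0 v); first by rewrite (orients_perm s0C).
  by rewrite flipE r0 vB permK setUC.
- move=> v vC; rewrite flipE; have sv := orients_out s0C vC.
  by case: ifP => // _; rewrite -{1}sv permK.
Qed.

(** One root per component of [C]: subsets of [Q] encode the sets of components to reverse. *)
Let Q : {set V} := [set v in vset C | roots (adj C) v].

Let mem_Q v : (v \in Q) = (v \in vset C) && (root v == v).
Proof. by rewrite inE. Qed.

(** At a root [v] in [B] but not in [B'], equal flips would give [s0^-1 v = s0 v], which is
    impossible on cycles of length at least 3. *)
Lemma flip_inj : {in powerset Q &, injective flip}.
Proof.
suff sub (B B' : {set V}) : B \subset Q -> flip B = flip B' -> B \subset B'.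
  move=> B B'; rewrite !inE => BQ B'Q eqB; apply/eqP.
  by rewrite eqEsubset (sub _ _ BQ) // (sub _ _ B'Q).
move=> /subsetP BQ eqB; apply/subsetP => v vB.
have := BQ v vB; rewrite mem_Q => /andP[vC /eqP rv].
have := congr1 (fun s : {perm V} => s v) eqB; rewrite !flipE rv vB.
case: ifP => // _ sv; move: vC; rewrite (orients_vset s0C) inE.
by rewrite -sv permKV eqxx.
Qed.

(* Once [s] agrees with [s0] at one vertex of a cycle it must agree along the
   whole cycle, since turning back would create a 2-cycle of [s]. *)
Lemma orients_flip s : orients s C -> s \in flip @: powerset Q.
Proof.
move=> sC; pose a := [pred v | s v == s0 v].
have nbr v : v \in vset C -> s v = s0 v \/ s0 (s v) = v.
  move/(orients_edge sC); rewrite (orients_eset s0C) => /imsetP[x _].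
  by case/set2_eq => [] [-> ->]; auto.
have aE v : (root v \in a) = (v \in a).
  suff cl_a : closed (frel s0) a.
    apply/esym/(closed_connect cl_a); rewrite -(connect_orients s0C).
    exact: connect_root.
  apply: (intro_closed (fconnect_sym perm_inj)) => x y /eqP <-; rewrite !inE.
  have [xC|xC] := boolP (x \in vset C); last by rewrite !(orients_out s0C xC).
  move/eqP=> sx; apply/eqP.
  have s0xC : s0 x \in vset C by rewrite (orients_perm s0C).
  have [//|s0s] := nbr _ s0xC.
  move: xC; rewrite (orients_vset sC) inE sx.
  by rewrite (perm_inj s0s) eqxx.
(* The components to reverse are those on which [s] disagrees with [s0]. *)
apply/imsetP; exists [set v in Q | v \notin a].
  by rewrite inE; apply/subsetP => v; rewrite inE => /andP[].
apply/permP => v; rewrite flipE inE aE mem_Q.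
have -> : (root v \in vset C) = (v \in vset C) := orients_root_vset s0C v.
have -> : root (root v) == root v.
  by apply/eqP/(root_root (orients_connect_sym s0C)).
case: (boolP (v \in vset C)) => [vC|vC] /=; last first.
  by rewrite (orients_out s0C vC) (orients_out sC vC).
have -> : (v \in a) = (s v == s0 v) by [].
have [->|sv /=] := eqVneq (s v) (s0 v); first by [].
have [sv'|s0s] := nbr v vC; first by rewrite sv' eqxx in sv.
by apply: (@perm_inj _ s0); rewrite permKV s0s.
Qed.

Lemma card_orients : #|[set s | orients s C]| = (2 ^ num_components C)%N.
Proof.
have -> : num_components C = #|Q|.
  by apply: eq_card => v; rewrite !inE andbC.
rewrite -card_powerset -(card_in_imset flip_inj); apply: eq_card => s.
rewrite inE; apply/idP/idP => [/orients_flip//|/imsetP[B _ ->]].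
exact: flip_orients.
Qed.

End Flips.

(** All [2 ^ num_components C] orientations contribute equally: the factor [-1] per vertex in the
    sign of [s] cancels the minus signs of the off-diagonal entries, leaving one [-1] per
    component. *)
Lemma orients_sum (R : comNzRingType) (G : sgraph V) (c : {set V} -> R) s0 C :
  orients s0 C -> eset C \subset eset G ->
  \sum_(s | orients s C) (-1) ^+ s * \prod_(v in vset C) laplacian_entry G c v (s v)
  = (- 2%:R) ^+ num_components C * \prod_(e in eset C) c e.
Proof.
move=> s0C /subsetP CG.
transitivity (\sum_(s | orients s C)
    (-1) ^+ num_components C * \prod_(e in eset C) c e).
  apply: eq_bigr => s sC; rewrite (orients_eset sC) big_imset /=; last first.
    exact: perm_edge_inj.
  rewrite -(orients_vset sC) (odd_orients sC) signr_addb !signr_odd.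
  have -> : \prod_(v in vset C) laplacian_entry G c v (s v) =
            \prod_(v in vset C) (- 1 * c [set v; s v]).
    apply: eq_bigr => v vC; rewrite /laplacian_entry mulN1r.
    rewrite (CG _ (orients_edge sC vC)) eq_sym.
    by rewrite (negPf (long_support_moved _)) // -(orients_vset sC).
  rewrite big_split /= prodr_const mulrACA.
  by rewrite -expr2 sqrr_sign mul1r.
rewrite sumr_const -cardsE (card_orients s0C) -[LHS]mulr_natl natrX mulrA.
by rewrite -exprMn mulrN1.
Qed.

End PermGraph.

(** * Cycle unions *)

Section CycleUnions.

Variable V : finType.
Implicit Types (G C K : sgraph V).

Lemma next_out (s : seq V) x : x \notin s -> next s x = x.
Proof. by rewrite next_nth => /negPf->. Qed.

(** Once [x] is rotated to the front, two steps lead to the third entry, which differs from [x]. *)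
Lemma next_next_neq (s : seq V) x :
  uniq s -> (2 < size s)%N -> (next s (next s x) != x) = (x \in s).
Proof.
move=> us s2; have [xs|xs] := boolP (x \in s); last by rewrite !next_out ?eqxx.
have [i s' rs] := rot_to xs; rewrite -!(next_rot i us) rs.
have: uniq (rot i s) by rewrite rot_uniq.
have: (2 < size (rot i s))%N by rewrite size_rot.
rewrite rs; case: s' {rs} => [|y [|z s']] //= _; rewrite !inE !negb_or.
case/and3P => /and3P[xy xz _] /andP[yz _] _.
by rewrite eqxx (eq_sym y) (negPf xy) eqxx (eq_sym z) xz.
Qed.

Lemma is_cycleP K :
  reflect (exists s : seq V,
             [/\ uniq s, (2 < size s)%N, vset K = [set x in s]
               & eset K = [set [set x; next s x] | x in s]])
          (is_cycle K).
Proof.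
apply: (iffP andP) => [[K2 /existsP[s /and3P[us /eqP vK /eqP eK]]]|].
  by exists s; rewrite size_tuple.
case=> s [us s2 vK eK].
have cardK : #|vset K| = size s by rewrite vK cardsE; apply/card_uniqP.
split; first by rewrite cardK.
have size_s : size s == #|vset K| by rewrite cardK.
apply/existsP; exists (Tuple size_s); apply/and3P; split=> //.
  by apply/eqP; exact: vK.
by apply/eqP; exact: eK.
Qed.

(** The map [next s], with inverse [prev s], is an orientation; length above 2 puts the whole cycle
    in its long support. *)
Lemma is_cycle_orients K : is_cycle K -> exists s, orients s K.
Proof.
case/is_cycleP => s [us s2 vK eK].
have nextE x : perm (can_inj (prev_next us)) x = next s x by rewrite permE.
exists (perm (can_inj (prev_next us))); apply: orientsP.
- by apply/setP => x; rewrite vK !inE !nextE next_next_neq.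
- move=> x; rewrite vK inE => xs; rewrite nextE eK.
  by apply/imsetP; exists x.
- move=> e; rewrite eK => /imsetP[x xs ->]; apply/imsetP; exists x.
    by rewrite vK inE.
  by rewrite nextE.
- by move=> x; rewrite vK inE nextE => /next_out.
Qed.

(** Orientations of the pieces glue to one permutation, since the pieces are disjoint and each is
    preserved by its own orientation. *)
Lemma disjoint_union_orients (P : {set sgraph V}) C :
  {in P, forall K, exists s, orients s K} ->
  {in P &, forall K K', K != K' -> [disjoint vset K & vset K']} ->
  vset C = \bigcup_(K in P) vset K -> eset C = \bigcup_(K in P) eset K ->
  exists s, orients s C.
Proof.
move=> Por Pdis vC eC.
pose sK K : {perm V} := odflt 1%g [pick s | orients s K].
have sKP K : K \in P -> orients (sK K) K.
  move/Por => [s sK']; rewrite /sK; case: pickP => //= /(_ s).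
  by rewrite sK'.
pose f v := if [pick K in P | v \in vset K] is Some K then sK K v else v.
have fE K v : K \in P -> v \in vset K -> f v = sK K v.
  rewrite /f => KP vK; case: pickP => [K' /andP[K'P vK']|/(_ K)]; last first.
    by rewrite KP vK.
  suff -> : K' = K by [].
  apply/eqP; apply: contraT => /(Pdis _ _ K'P KP)/disjointFr/(_ vK').
  by rewrite vK.
have f_out v : v \notin vset C -> f v = v.
  rewrite /f vC => vP; case: pickP => // K /andP[KP vK].
  by case/bigcupP: vP; exists K.
have f_inj : injective f.
  have f_vC v : (f v \in vset C) = (v \in vset C).
    have [|vP] := boolP (v \in vset C); last by rewrite f_out // (negPf vP).
    rewrite {1}vC => /bigcupP[K KP vK]; rewrite vC (fE K) //.
    by apply/bigcupP; exists K; rewrite // (orients_perm (sKP K KP)).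
  move=> u v fuv; have := f_vC u; rewrite fuv f_vC.
  have [uC vC'|uC vC'] := boolP (u \in vset C); last first.
    by rewrite -(f_out u uC) fuv f_out ?vC'.
  move: vC' uC; rewrite vC => /bigcupP[K KP vK] /bigcupP[K' K'P uK'].
  move: fuv; rewrite (fE K v) // (fE K' u) // => eqs.
  have eqK : K' = K.
    apply/eqP; apply: contraT => /(Pdis _ _ K'P KP)/pred0P/(_ (sK K v)) /=.
    by rewrite (orients_perm (sKP K KP)) vK -eqs (orients_perm (sKP K' K'P)) uK'.
  by move: eqs; rewrite eqK; apply: perm_inj.
exists (perm f_inj); apply: orientsP.
- apply/setP => v; rewrite !inE !permE.
  have [|vP] := boolP (v \in vset C); last by rewrite !f_out ?eqxx.
  rewrite vC => /bigcupP[K KP vK].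
  rewrite (fE K v) // (fE K) ?(orients_perm (sKP K KP)) //.
  by move: vK; rewrite (orients_vset (sKP K KP)) inE.
- move=> v; rewrite vC eC => /bigcupP[K KP vK]; apply/bigcupP; exists K => //.
  by rewrite permE (fE K) // orients_edge // sKP.
- move=> e; rewrite eC => /bigcupP[K KP]; rewrite (orients_eset (sKP K KP)).
  rewrite -(orients_vset (sKP K KP)) => /imsetP[v vK ->].
  apply/imsetP; exists v; first by rewrite vC; apply/bigcupP; exists K.
  by rewrite permE (fE K).
- by move=> v /f_out; rewrite permE.
Qed.

(** * Components of an oriented graph are cycles *)

Section Components.

Variables (s : {perm V}) (C : sgraph V).
Hypothesis sC : orients s C.

Definition component v : sgraph V := delete C [set u | ~~ fconnect s v u].

Lemma vset_component v :
  v \in vset C -> vset (component v) = [set u | fconnect s v u].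
Proof.
move=> vC; apply/setP => u; rewrite !inE negbK andbC.
have [/iter_findex <-|_] := boolP (fconnect s v u); last by rewrite andbF.
by rewrite andbT; elim: (findex _ _ _) => //= n; rewrite (orients_perm sC).
Qed.

Lemma eset_component v :
  v \in vset C ->
  eset (component v) = [set [set x; s x] | x in [set u | fconnect s v u]].
Proof.
move=> vC; apply/setP => e; rewrite inE (orients_eset sC) -(orients_vset sC).
have disE x : [disjoint [set x; s x] & [set u | ~~ fconnect s v u]] =
    fconnect s v x.
  rewrite disjoint_sym disjoints_subset.
  apply/subsetP/idP => [vx|vx u].
    by apply: contraT => nvx; have := vx x; rewrite !inE nvx eqxx => /(_ isT).
  rewrite !inE; apply: contra => /orP[]/eqP-> //.
  by rewrite -same_fconnect1_r //; apply: perm_inj.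
apply/andP/imsetP => [[/imsetP[x xC ->]]|[x]].
  by rewrite disE => vx; exists x; rewrite ?inE.
move=> xv ->; split; last by rewrite disE; rewrite inE in xv.
by apply: imset_f; move: xv; rewrite -vset_component // => /setDP[].
Qed.

(** The orbit of [v], listed in order, is the required sequence: [next] agrees with [s] on it, and
    [v], [s v], [s (s v)] are distinct. *)
Lemma component_cycle v : v \in vset C -> is_cycle (component v).
Proof.
have sP := @perm_inj _ s; move=> vC; apply/is_cycleP.
have KO : [set u | fconnect s v u] = [set x in fingraph.orbit s v].
  by apply/setP => x; rewrite !inE fconnect_orbit.
exists (fingraph.orbit s v); split.
- exact: orbit_uniq.
- have := vC; rewrite (orients_vset sC) => vs.
  have sv := long_support_moved vs.
  have ssv : s (s v) != s v.
    by apply: long_support_moved; rewrite long_support_perm.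
  suff sub : {subset [:: v; s v; s (s v)] <= fingraph.orbit s v}.
    apply: (uniq_leq_size _ sub) => /=.
    rewrite !inE negb_or eq_sym sv [s v == _]eq_sym ssv eq_sym.
    by move: vs; rewrite inE => ->.
  by move=> x; rewrite !inE -fconnect_orbit => /or3P[] /eqP->;
    rewrite -?(same_fconnect1_r sP) connect0.
- by rewrite vset_component.
rewrite eset_component // KO; apply/setP => e.
have sE : {in fingraph.orbit s v, next (fingraph.orbit s v) =1 s}.
  by move=> x; apply: nextE; apply: cycle_orbit.
by apply/imsetP/imsetP => -[x]; rewrite ?inE => xo ->; exists x;
  rewrite ?inE ?sE.
Qed.

Lemma orients_cycle_union G :
  vset C != set0 -> subgraph C G -> C \in cycle_unions G.
Proof.
move=> C0 /andP[vCG eCG]; rewrite inE; apply/existsP.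
exists [set component v | v in vset C]; apply/and5P; split.
- by rewrite imset_eq0.
- apply/forall_inP => _ /imsetP[v vC ->]; rewrite component_cycle //=.
  apply/andP; split; first exact: subset_trans (subsetDl _ _) vCG.
  by apply/subset_trans: eCG; apply/subsetP => e; rewrite inE => /andP[].
- apply/forall_inP => _ /imsetP[u uC ->]; apply/forall_inP => _ /imsetP[v vC ->].
  (* A shared vertex forces equal orbits, hence equal components. *)
  apply/implyP; apply: contraNT => /pred0Pn[x /= /andP[]].
  rewrite !vset_component // !inE => ux vx; apply/eqP; congr delete.
  apply/setP => y; rewrite !inE; congr negb.
  have sym := fconnect_sym (@perm_inj _ s).
  by rewrite (same_connect sym ux) (same_connect sym vx).
- apply/eqP/setP => v; apply/idP/bigcupP => [vC|[_ /imsetP[u uC ->]]].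
    exists (component v); first exact: imset_f.
    by rewrite vset_component // inE connect0.
  by case/setDP.
- apply/eqP/setP => e; apply/idP/bigcupP => [|[_ /imsetP[u uC ->]]]; last first.
    by rewrite inE => /andP[].
  rewrite (orients_eset sC) -(orients_vset sC) => /imsetP[v vC ->].
  exists (component v); first exact: imset_f.
  by rewrite eset_component //; apply: imset_f; rewrite inE connect0.
Qed.

End Components.

(** Replaces a family of cycles by the existence of an orientation, the form in which [C] arises
    from the determinant. *)
Lemma mem_cycle_unions G C :
  (C \in cycle_unions G) =
  [&& vset C != set0, subgraph C G & [exists s, orients s C]].
Proof.
apply/idP/and3P => [|[C0 CG /existsP[s sC]]]; last first.
  exact: (orients_cycle_union sC).
rewrite inE => /existsP[P /and5P[P0 /forall_inP Pcyc /forall_inP Pdis]].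
move=> /eqP vC /eqP eC; split.
- have /set0Pn[K KP] := P0; have /andP[/andP[K2 _] _] := Pcyc K KP.
  have /card_gt0P[v vK] : (0 < #|vset K|)%N by apply: leq_trans K2.
  by apply/set0Pn; exists v; rewrite vC; apply/bigcupP; exists K.
- rewrite /subgraph vC eC; apply/andP; split; apply/bigcupsP => K /Pcyc.
    by case/andP => _ /andP[].
  by case/andP => _ /andP[].
apply/existsP; apply: (disjoint_union_orients _ _ vC eC) => [K /Pcyc/andP[cK _]|].
  exact: is_cycle_orients.
by move=> K K' /Pdis/forall_inP Pd /Pd/implyP.
Qed.

End CycleUnions.

(** * Splitting off the long cycles *)

Section Decomposition.

Variable V : finType.
Implicit Types (X S : {set V}) (s t i : {perm V}) (C : sgraph V).

Lemma restr_perm_stableE S s v :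
  {in S, forall u, s u \in S} -> restr_perm S s v = if v \in S then s v else v.
Proof.
move=> sS; case: ifPn => vS; last first.
  by rewrite (out_perm (restr_perm_on S s)).
rewrite restr_permE // !inE; apply/subsetP => u uS.
by rewrite inE /= apermE sS.
Qed.

Section Fixed.

Variables (X : {set V}) (C : sgraph V).
Hypothesis CX : vset C \subset X.
Let S := vset C.

Lemma orients_mulE t i v :
  orients t C -> perm_on (X :\: S) i ->
  (t * i)%g v = if v \in S then t v else i v.
Proof.
move=> tC iD; rewrite permM; case: ifPn => vS; last first.
  by rewrite (orients_out tC).
by rewrite (out_perm iD) // inE /S (orients_perm tC) vS.
Qed.

(** On [S] the product acts as [t], which has no 2-cycles there; elsewhere it acts as the involution
    [i]. *)
Lemma long_support_mul t i :
  orients t C -> perm_on (X :\: S) i -> (i * i)%g = 1%g ->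
  long_support (t * i)%g = S.
Proof.
move=> tC iD ii; apply/setP => v; rewrite inE !(orients_mulE _ tC iD).
have [vS|vS] := boolP (v \in S).
  rewrite /S (orients_perm tC) vS.
  by move: vS; rewrite /S (orients_vset tC) inE.
suff /negPf-> : i v \notin S by rewrite -permM ii perm1 eqxx.
have [vD|vD] := boolP (v \in X :\: S); last by rewrite (out_perm iD).
by move: vD; rewrite -(perm_closed v iD) => /setDP[].
Qed.

Lemma stable_long_support s : S = long_support s -> {in S, forall v, s v \in S}.
Proof. by move=> -> v; rewrite long_support_perm. Qed.

Lemma stable_setC s : S = long_support s -> {in ~: S, forall v, s v \in ~: S}.
Proof. by move=> -> v; rewrite !in_setC long_support_perm. Qed.

(** Since [s] preserves its long support [S], it is the product of its restrictions to [S] and to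
    the complement; on the latter [s (s v) = v] by definition of [long_support]. *)
Lemma perm_graph_split s :
  perm_on X s && (perm_graph s == C) ->
  [/\ orients (restr_perm S s) C,
      perm_on (X :\: S) (restr_perm (~: S) s),
      (restr_perm (~: S) s * restr_perm (~: S) s)%g = 1%g
    & (restr_perm S s * restr_perm (~: S) s)%g = s].
Proof.
case/andP => sX /eqP sC; have SE : S = long_support s by rewrite /S -sC.
have rS v := restr_perm_stableE v (stable_long_support SE).
have rD v := restr_perm_stableE v (stable_setC SE).
have sS v : (s v \in S) = (v \in S) by rewrite SE long_support_perm.
have tC : orients (restr_perm S s) C.
  apply: orientsP.
  - apply/setP => v; rewrite -/S inE !rS.
    case: (boolP (v \in S)) => vS; rewrite ?sS ?vS ?(negPf vS) ?eqxx //.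
    by move: vS; rewrite SE inE => ->.
  - move=> v vS; rewrite rS vS -sC; apply: imset_f.
    by rewrite -SE.
  - move=> e; rewrite -sC => /imsetP[v]; rewrite -SE => vS ->.
    rewrite sC; apply/imsetP; exists v; first by [].
    by rewrite rS vS.
  - by move=> v vS; rewrite rS (negPf vS).
have iD : perm_on (X :\: S) (restr_perm (~: S) s).
  apply/subsetP => v; rewrite !inE rD inE; case: (v \in S); first by rewrite eqxx.
  by move=> sv; apply: (subsetP sX); rewrite inE.
split=> //.
- apply/permP => v; rewrite permM perm1 !rD !inE.
  case: (boolP (v \in S)) => vS /=; first by rewrite vS.
  by rewrite sS vS; apply/eqP; move: vS; rewrite SE inE negbK.
- by apply/permP => v; rewrite (orients_mulE _ tC iD) rS rD inE; case: (v \in S).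
Qed.

Lemma perm_graph_join t i :
  orients t C -> perm_on (X :\: S) i -> (i * i)%g = 1%g ->
  [/\ perm_on X (t * i)%g, perm_graph (t * i) = C,
      restr_perm S (t * i) = t & restr_perm (~: S) (t * i) = i].
Proof.
move=> tC iD ii; have sE v := orients_mulE v tC iD.
have SE := esym (long_support_mul tC iD ii).
split.
- apply: perm_onM; last exact: subset_trans iD (subsetDl _ _).
  by case/andP: tC => tS _; apply: subset_trans tS CX.
- apply: sgraph_eq; first exact: esym SE.
  rewrite (orients_eset tC) -(orients_vset tC) -/S.
  apply: etrans (_ : [set [set v; (t * i)%g v] | v in S] = _).
    by rewrite SE.
  by apply: eq_in_imset => v vS; rewrite sE vS.
- apply/permP => v; rewrite (restr_perm_stableE _ (stable_long_support SE)) sE.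
  by case: (boolP (v \in S)) => // vS; rewrite (orients_out tC).
- apply/permP => v; rewrite (restr_perm_stableE _ (stable_setC SE)) sE inE.
  case: (boolP (v \in S)) => //= vS.
  by rewrite (out_perm iD) // inE vS.
Qed.

(** Splitting and joining are inverse bijections between permutations and pairs [(t, i)]; signs
    multiply and the product over [X] separates along [S]. *)
Lemma perm_graph_sum (R : comNzRingType) (A : V -> V -> R) :
  \sum_(s | perm_on X s && (perm_graph s == C))
     (-1) ^+ s * \prod_(v in X) A v (s v) =
  (\sum_(t | orients t C) (-1) ^+ t * \prod_(v in S) A v (t v)) *
  (\sum_(i | perm_on (X :\: S) i && (i * i == 1)%g)
     (-1) ^+ i * \prod_(v in X :\: S) A v (i v)).
Proof.
rewrite big_distrlr pair_big /=.
rewrite (reindex_onto (fun p : {perm V} * {perm V} => (p.1 * p.2)%g)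
           (fun s => (restr_perm S s, restr_perm (~: S) s))); last first.
  by move=> s /perm_graph_split[].
apply: eq_big => [[t i] /=|[t i] /= /andP[sXC /eqP[tE iE]]].
  apply/andP/and3P => [[sXC /eqP[tE iE]]|[tC iD /eqP ii]].
    have [tC iD ii _] := perm_graph_split sXC; rewrite tE iE in tC iD ii.
    by rewrite tC iD ii.
  have [-> -> -> ->] := perm_graph_join tC iD ii.
  by rewrite !eqxx.
have [tC iD ii _] := perm_graph_split sXC; rewrite tE iE in tC iD ii.
rewrite odd_permM signr_addb (big_setID S) /= (setIidPr CX) mulrACA.
congr (_ * _ * (_ * _)); apply: eq_bigr => v.
  by move=> vS; rewrite (orients_mulE _ tC iD) vS.
by case/setDP => _ vS; rewrite (orients_mulE _ tC iD) (negPf vS).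
Qed.

End Fixed.

End Decomposition.

(** * Edges of the subdivision that survive vertex deletions *)

Section SubdivisionEdges.

Variables (V : finType) (G : sgraph V).

Lemma disjoint_half_edge v e (B : {set (V + {set V})%type}) :
  [disjoint half_edge v e & B] = (inl v \notin B) && (inr e \notin B).
Proof. by rewrite disjoints_subset subUset !sub1set !inE. Qed.

(** Two successive deletions cover both kinds of graph in the theorem, with [A] empty when no cycle
    union is removed. *)
Lemma eset_delete_subdivision (A B : {set (V + {set V})%type}) (Y : {set V}) :
  Y \subset vset G ->
  (forall v e, v \in vset G -> e \in eset G -> v \in e ->
     (inl v \notin A :|: B) && (inr e \notin A :|: B) = (v \in Y)) ->
  eset (delete (delete (subdivision G) A) B) =
  [set half_edge v e | v in Y, e in eset G & v \in e].
Proof.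
move=> /subsetP YG ABY; apply/setP => m; rewrite !inE.
apply/andP/imset2P => [[/andP[/imset2P[v e vG]]]|[v e vY]].
  rewrite inE => /andP[eG ve] -> mA mB; exists v e; rewrite ?inE ?eG //.
  rewrite -(ABY v e) // !inE !negb_or andbACA.
  by rewrite -!disjoint_half_edge mA mB.
rewrite inE => /andP[eG ve] ->; have := ABY v e (YG v vY) eG ve.
rewrite vY !inE !negb_or andbACA -!disjoint_half_edge => /andP[-> ->].
by split=> //; rewrite andbT; apply/imset2P; exists v e; rewrite ?inE ?eG ?YG.
Qed.

End SubdivisionEdges.

(** * The expansion *)

Lemma orients_empty (V : finType) : orients 1 (perm_graph (1 : {perm V})).
Proof. by rewrite /orients perm_on1 eqxx. Qed.

Lemma vset_perm_graph1 (V : finType) : vset (perm_graph (1 : {perm V})) = set0.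
Proof. by apply/setP => v; rewrite !inE !perm1 eqxx. Qed.

Lemma eset_perm_graph1 (V : finType) : eset (perm_graph (1 : {perm V})) = set0.
Proof.
by rewrite (orients_eset (orients_empty V)) -(orients_vset (orients_empty V))
  vset_perm_graph1 imset0.
Qed.

(** Either no permutation orients [C], or an edge of [C] outside [G] gives a zero Laplacian entry in
    every term. *)
Lemma orients_sum0 (R : comNzRingType) (V : finType) (G : sgraph V)
    (c : {set V} -> R) C :
  ~~ ([exists s, orients s C] && (eset C \subset eset G)) ->
  \sum_(s | orients s C)
    (-1) ^+ s * \prod_(v in vset C) laplacian_entry G c v (s v) = 0.
Proof.
rewrite negb_and => /orP[nC|/subsetPn[e eC eG]].
  rewrite big_pred0 // => s; apply: contraNF nC => sC.
  by apply/existsP; exists s.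
apply: big1 => s sC; move: eC; rewrite (orients_eset sC) => /imsetP[v vs ee].
rewrite (bigD1 v) ?(orients_vset sC) //= /laplacian_entry -ee (negPf eG).
by rewrite eq_sym (negPf (long_support_moved vs)) mul0r mulr0.
Qed.

(** Grouping permutations by [perm_graph s] makes each group factor into orientations of [C] and
    involutions off [C]. The empty graph is still among the [C]. *)
Lemma det_principal_laplacian (R : comNzRingType) (V : finType) (G : sgraph V)
    (c : {set V} -> R) (X : {set V}) :
  \det (principal_submx (laplacian G c) X) =
  \sum_(C : sgraph V | [&& vset C \subset X, [exists s, orients s C]
                         & eset C \subset eset G])
    (- 2%:R) ^+ num_components C * (\prod_(e in eset C) c e) *
    \sum_(f in edge_choices G (X :\: vset C) | dinjectiveb f (X :\: vset C))
      \prod_(v in X :\: vset C) c (f v).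
Proof.
rewrite (@det_principal_submx _ _ (laplacian_entry G c)); last first.
  by move=> u v; rewrite mxE !enum_rankK.
rewrite (partition_big (@perm_graph V) predT) //= [RHS]big_mkcond.
apply: eq_bigr => C _; case: (boolP (vset C \subset X)) => [CX|CX] /=; last first.
  rewrite big_pred0 // => s; apply: contraNF CX => /andP[/subsetP sX /eqP<-].
  by apply/subsetP => v /long_support_moved; apply: sX.
rewrite (perm_graph_sum CX) involution_sum.
case: ifPn => [/andP[/existsP[s sC] CG]|nC]; first by rewrite (orients_sum _ sC).
by rewrite orients_sum0 // mul0r.
Qed.

Theorem theorem7p1 (R : realFieldType) (V : finType) (G : sgraph V)
    (c : {set V} -> R)
    (G_verts : vset G = [set: V])
    (G_conn : connected G)
    (c_gt0 : forall e : {set V}, e \in eset G -> 0 < c e)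
    (X : {set V}) :
  let w := subdivision_weight c in
  let RX := [set (inl v : V + {set V}) | v in ~: X] in
  let SX := delete (subdivision G) RX in
  let SXC (C : sgraph V) :=
    delete (delete (subdivision G) (vset (subdivision C))) RX in
  \det (principal_submx (laplacian G c) X) =
    matching_weight w SX #|X|
    + \sum_(C in cycle_unions G | vset C \subset X)
        (- 2%:R) ^+ num_components C
        * (\prod_(e in eset C) c e)
        * matching_weight w (SXC C) (#|X| - #|vset C|)%N.
Proof.
move=> w RX SX SXC.
have inl_RX v : (inl v \in RX) = (v \notin X).
  by rewrite mem_imset ?inE // => ? ? [].
have inr_RX e : (inr e \in RX) = false by apply/imsetP => -[].
have inl_SC C v : (inl v \in vset (subdivision C)) = (v \in vset C).
  rewrite /vset /= inE mem_imset => [|? ? []//].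
  by rewrite orbC; case: imsetP => [[]|].
have inr_SC C e : (inr e \in vset (subdivision C)) = (e \in eset C).
  rewrite /vset /= inE mem_imset => [|? ? []//].
  by case: imsetP => [[]|].
have SXCE C : vset C \subset X -> matching_weight w (SXC C) (#|X| - #|vset C|) =
    \sum_(f in edge_choices G (X :\: vset C) | dinjectiveb f (X :\: vset C))
      \prod_(v in X :\: vset C) c (f v).
  move=> CX; rewrite -cardsDS //; apply: matching_weight_choices.
  apply: eset_delete_subdivision => [|v e vG eG ve].
    by rewrite G_verts subsetT.
  rewrite (in_setU (inl v)) (in_setU (inr e)) !negb_or.
  rewrite inl_RX inr_RX inl_SC inr_SC negbK andbT inE.
  case: (boolP (v \in vset C)) => //= vC.
  (* If [inr e] is deleted then [e] is an edge of [C], so its end [v] already lies in [C]. *)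
  rewrite andb_idr // => _; apply: contra vC => eC.
  exact: (subsetP (eset_sub eC)).
(* The empty graph, whose term in the expansion is the pure matching term of the theorem. *)
pose C0 := perm_graph (1 : {perm V}).
have C0v : vset C0 = set0 := vset_perm_graph1 V.
have C0e : eset C0 = set0 := eset_perm_graph1 V.
have SXE : matching_weight w SX #|X| =
    \sum_(f in edge_choices G X | dinjectiveb f X) \prod_(v in X) c (f v).
  apply: matching_weight_choices.
  rewrite -(@eset_delete_subdivision _ _ set0 RX) ?G_verts //.
    by apply/setP => m; rewrite !inE -!setI_eq0 setI0 eqxx andbT.
  by move=> v e _ _ _; rewrite !in_setU !in_set0 /= inl_RX inr_RX negbK andbT.
rewrite det_principal_laplacian (bigD1 C0) /=; last first.
  rewrite C0v C0e !sub0set andbT /=; apply/existsP; exists 1%g.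
  exact: orients_empty.
rewrite C0v C0e setD0 big_set0 mulr1 -SXE.
have -> : num_components C0 = 0%N.
  by rewrite /num_components C0v; apply: eq_card0 => v; rewrite !inE andbF.
rewrite expr0 mul1r; congr (_ + _); apply: eq_big => [C|C].
  rewrite mem_cycle_unions /subgraph G_verts subsetT /=.
  case: (vset C \subset X); rewrite ?andbF ?andbT //=.
  case: existsP => [[s sC]|_]; last by rewrite !andbF.
  rewrite andbT andbC; case: (eset C \subset _); rewrite ?andbF ?andbT //=.
  (* An oriented graph without vertices has no edges, so excluding [C0] is the same as requiring a
     vertex. *)
  apply: congr1; apply/eqP/eqP => [->//|Cv]; apply: sgraph_eq; rewrite ?C0v ?C0e //.
  by rewrite (orients_eset sC) -(orients_vset sC) Cv imset0.
by case/andP => /and3P[CX _ _] _; rewrite SXCE.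
Qed.
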